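(* $NPO(4)=10$.
   Context: All graphs are finite, simple and undirected; $A(G)$ denotes the adjacency matrix of $G$. Eigenvalues are counted with multiplicity. For a positive integer $k$, $NPO(k)$ is the smallest integer $n$ such that the adjacency matrix of every graph with at least $n$ vertices has at least $k$ nonpositive eigenvalues. *)

(* Defs.v *)
(* Eigenvalues are taken over algC (algebraic complex numbers),
   which contains all eigenvalues of an integer matrix. *)
From HB Require Import structures.
From mathcomp Require Import all_boot all_order all_algebra all_field.
Set Implicit Arguments. Unset Strict Implicit. Unset Printing Implicit Defensive.
Import Order.TTheory GRing.Theory Num.Theory.
Local Open Scope ring_scope.

Definition simple_graph (T : finType) (e : rel T) : Prop :=
  symmetric e /\ irreflexive e.

Definition adjmx (T : finType) (e : rel T) : 'M[algC]_#|T| :=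
  \matrix_(i, j) (e (enum_val i) (enum_val j))%:R.

(* The eigenvalues of a square matrix, listed with multiplicity: the roots of
   its characteristic polynomial (which splits over algC). *)
Definition eigenvalues (n : nat) (A : 'M[algC]_n) : seq algC :=
  sval (closed_field_poly_normal (char_poly A)).

Definition num_nonpos_eig (n : nat) (A : 'M[algC]_n) : nat :=
  count (fun x : algC => x <= 0) (eigenvalues A).

Definition NPO_prop (k n : nat) : Prop :=
  forall (T : finType) (e : rel T), simple_graph e ->
    (n <= #|T|)%N -> (k <= num_nonpos_eig (adjmx e))%N.

Definition is_NPO (k m : nat) : Prop :=
  NPO_prop k m /\ forall n, NPO_prop k n -> (m <= n)%N.

(* Main.v *)
(* A symmetric matrix has at least k nonpositive eigenvalues as soon as its
   quadratic form is nonpositive on a subspace of dimension k, and at most n - k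
   as soon as it is positive on one.

   Upper bound: the bilinear form of a graph on 10 vertices is diagonalized by
   Gram-Schmidt, vertex by vertex. All that matters about a vertex not yet used
   is its list of products with the orthogonal vectors found so far, and this
   list only depends on its adjacencies to the vertices used. So one can branch
   on the list of the next vertex and on the adjacencies it adds. A branch ends
   with four orthogonal vectors of nonpositive norm, and the resulting search
   tree is finite and has only a few thousand nodes. When every remaining vertex
   has an isotropic residue, either two of these residues have a nonzero product
   and span a hyperbolic plane, which supplies a vector of each sign, or they
   span a totally isotropic subspace, which is large enough to conclude.

   Lower bound: a graph on 9 vertices with a 6-dimensional positive subspace. *)
Require Import Defs.
From Stdlib Require Import ZArith QArith Lia.
From HB Require Import structures.
From mathcomp Require Import all_boot all_order all_algebra all_field.
From mathcomp Require Import zify ssrZ ring.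
Set Implicit Arguments. Unset Strict Implicit. Unset Printing Implicit Defensive.
Import Order.TTheory GRing.Theory Num.Theory.
Local Open Scope ring_scope.
Local Open Scope sesquilinear_scope.

(** * Characteristic polynomials and diagonalization *)

Lemma char_poly_conj (F : fieldType) n (P A : 'M[F]_n) :
  P \in unitmx -> char_poly (invmx P *m A *m P) = char_poly A.
Proof.
move=> Pu; rewrite /char_poly /char_poly_mx !map_mxM /= map_invmx.
have Qu : map_mx polyC P \in unitmx by rewrite map_unitmx.
have {1}-> : 'X%:M = invmx (map_mx polyC P) *m 'X%:M *m map_mx polyC P.
  by rewrite -mulmxA mul_scalar_mx -scalemxAr mulVmx // scalemx1.
rewrite -mulmxBl -mulmxBr !det_mulmx mulrAC -det_mulmx mulVmx //.
by rewrite det1 mul1r.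
Qed.

Lemma perm_eigenvalues n (P : 'M[algC]_n) (d : 'rV_n) : P \in unitmx ->
  perm_eq (eigenvalues (invmx P *m diag_mx d *m P)) [seq d 0 i | i : 'I_n].
Proof.
move=> Pu; rewrite /eigenvalues; case: closed_field_poly_normal => r /=.
rewrite (monicP (char_poly_monic _)) scale1r char_poly_conj //.
rewrite char_poly_trig ?diag_mx_is_trig // => rE; rewrite perm_sym.
apply: prod_XsubC_eq; rewrite -rE big_map big_enum /=.
by apply: eq_bigr => i _; rewrite mxE eqxx.
Qed.

Lemma diag_form n (d z : 'rV[algC]_n) :
  (z *m diag_mx d *m z ^t*) 0 0 = \sum_i d 0 i * `|z 0 i| ^+ 2.
Proof.
rewrite mul_mx_diag !mxE; apply: eq_bigr => i _.
by rewrite !mxE normCK mulrCA mulrA.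
Qed.

(** The columns in [S] form a matrix with [k] rows and rank below [k], which has a nonzero left
    kernel. *)
Lemma mask_kernel (F : fieldType) n k (V : 'M[F]_(k, n)) (S : pred 'I_n) :
  (#|S| < k)%N -> exists2 u : 'rV_k, u != 0 & forall i, i \in S -> (u *m V) 0 i = 0.
Proof.
move=> ltSk; pose W := \matrix_(i < k, j < #|S|) V i (enum_val j).
have : kermx W != 0.
  rewrite kermx_eq0 /row_free neq_ltn.
  by rewrite (leq_ltn_trans (rank_leq_col W)).
case/rowV0Pn => u /sub_kermxP uW u0; exists u => // i iS.
move/rowP: uW => /(_ (enum_rank_in iS i)); rewrite [RHS]mxE.
by rewrite !mxE; under eq_bigr do rewrite mxE enum_rankK_in //.
Qed.

(** * Inertia of a Hermitian matrix *)

Section Inertia.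
Variables (n : nat) (A : 'M[algC]_n).
Hypothesis hA : A \is hermsymmx.

Let P := spectralmx A.
Let d := spectral_diag A.

Let nonpos := [pred i | d 0 i <= 0].

Lemma num_nonpos_eigE : num_nonpos_eig A = #|nonpos|.
Proof.
rewrite /num_nonpos_eig [X in eigenvalues X](orthomx_spectralP (hermitian_normalmx hA)).
rewrite (permP (perm_eigenvalues _ (spectral_unit A))) count_map.
by rewrite -sum1_count big_enum_cond sum1_card.
Qed.

Lemma form_spectral k (V : 'M[algC]_(k, n)) (u : 'rV_k) :
  let z := u *m (V *m P ^t*) in
  (u *m (V *m A *m V ^t*) *m u ^t*) 0 0 = \sum_i d 0 i * `|z 0 i| ^+ 2.
Proof.
move=> z; rewrite -diag_form [in LHS](orthomx_spectralP (hermitian_normalmx hA)).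
rewrite invmx_unitary ?spectral_unitarymx //.
by rewrite /z !trmx_mul !map_mxM /= trmxCK !mulmxA.
Qed.

Lemma specP_inj k (V : 'M[algC]_(k, n)) (u : 'rV_k) :
  u *m (V *m P ^t*) = 0 -> u *m V = 0.
Proof.
move=> /(congr1 (mulmx^~ P)); rewrite mul0mx mulmxA mulmxKtV //.
exact: spectral_unitarymx.
Qed.

(** The order of [algC] is partial, but the eigenvalues of a Hermitian matrix are real, hence
    comparable with 0. *)
Lemma d_pos i : (0 < d 0 i) = ~~ (d 0 i <= 0).
Proof.
have dr : d 0 i \is Num.real by apply: (mxOverP (hermitian_spectral_diag_real hA)).
by rewrite real_ltNge // ?real0.
Qed.

(** With fewer than [k] nonpositive eigenvalues, a nonzero combination of the rows of [V] has no
    component along their eigenvectors. The form is there a sum of nonnegative terms, so all terms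
    vanish and the combination is zero, against row freeness. *)
Lemma nonpos_subspace k (V : 'M[algC]_(k, n)) : row_free V ->
  (forall u : 'rV_k, (u *m (V *m A *m V ^t*) *m u ^t*) 0 0 <= 0) ->
  (k <= num_nonpos_eig A)%N.
Proof.
move=> Vf Vneg; rewrite num_nonpos_eigE leqNgt; apply/negP => lt_k.
have [u /eqP u0 uz] := mask_kernel (V *m P ^t*) lt_k; apply: u0.
have /= := Vneg u; rewrite form_spectral /=; set z := _ *m _ => sum_le0.
apply/eqP; rewrite -(mulmx_free_eq0 _ Vf); apply/eqP/specP_inj/rowP => i.
rewrite [RHS]mxE.
have term_ge0 j : 0 <= d 0 j * `|z 0 j| ^+ 2.
  have [dj|] := boolP (d 0 j <= 0); first by rewrite uz ?normr0 ?expr0n ?mulr0.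
  by rewrite -d_pos => /ltW dj; rewrite mulr_ge0 ?exprn_ge0.
have : \sum_i d 0 i * `|z 0 i| ^+ 2 = 0.
  by apply/eqP; rewrite eq_le sum_le0 sumr_ge0.
move/eqP; rewrite psumr_eq0 // => /allP /(_ i); rewrite mem_index_enum => /(_ isT).
have [di _|] := boolP (d 0 i <= 0); first exact: uz.
by rewrite -d_pos => /lt0r_neq0/negPf di; rewrite /= mulf_eq0 di /= sqrf_eq0 normr_eq0 => /eqP.
Qed.

(** Dual count: with fewer than [k] positive eigenvalues, a nonzero combination of the rows has only
    nonpositive terms. *)
Lemma pos_subspace k (V : 'M[algC]_(k, n)) :
  (forall u : 'rV_k, u != 0 -> 0 < (u *m (V *m A *m V ^t*) *m u ^t*) 0 0) ->
  (num_nonpos_eig A + k <= n)%N.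
Proof.
move=> Vpos; rewrite leqNgt; apply/negP => lt_n.
have lt_k : (#|[predC nonpos]| < k)%N.
  by rewrite -(ltn_add2l (num_nonpos_eig A)) {1}num_nonpos_eigE cardC card_ord.
have [u /Vpos + uz] := mask_kernel (V *m P ^t*) lt_k.
rewrite form_spectral /=; set z := _ *m _.
move=> /lt_geF /negP; apply; apply: sumr_le0 => i _.
have [di|/uz ->] := boolP (i \in nonpos).
  by rewrite mulr_le0_ge0 ?exprn_ge0.
by rewrite normr0 expr0n mulr0.
Qed.
End Inertia.

(** * The search procedure, over binary rationals *)

Local Open Scope Q_scope.

Definition qpos (q : Q) : bool := Z.ltb 0 (Qnum q).
Definition qneg (q : Q) : bool := Z.ltb (Qnum q) 0.
Definition qzero (q : Q) : bool := Z.eqb (Qnum q) 0.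

(* With [ds] the norms of pairwise orthogonal vectors [v] and [c], [c'] the lists
   of products of [v] with two vertices whose adjacency is [a], this is the
   product of the components of these two vertices orthogonal to every [v]. *)
Fixpoint resid (ds c c' : seq Q) (a : Q) : Q :=
  match ds, c, c' with
  | d :: ds1, x :: c1, x' :: c1' => resid ds1 c1 c1' (a - x * x' / d)
  | _, _, _ => Qred a
  end.

(* Case split on the first [x] of [s] that occurs: [f] gets the suffix starting
   at [x] because the earlier elements are then excluded. *)
Fixpoint each (T : Type) (f : T -> seq T -> bool) (s t : seq T) : bool :=
  if s is x :: s' then f x (s ++ t) && each f s' t else true.

Definition bits : seq Q := [:: 0; 1].

(** The adjacency of a candidate to the vertex just used is unknown, so both values are kept. *)
Definition extend1 ds c (cs : seq (seq Q)) :=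
  [seq resid ds c z a :: z | z <- cs, a <- bits].

(* For two isotropic components [u], [u'] with nonzero product, the new
   orthogonal vectors are [u + u'] and [u - u']. *)
Definition extend2 ds c c' (cs : seq (seq Q)) :=
  [seq [:: resid ds c z b.1 + resid ds c' z b.2,
           resid ds c z b.1 - resid ds c' z b.2 & z]
     | z <- cs, b <- [seq (b1, b2) | b1 <- bits, b2 <- bits]].

(* [ds] lists the norms of orthogonal vectors spanning a nondegenerate subspace
   supported on some vertices, [m] bounds from below the number of other
   vertices, and [cs] contains, for each of these, the list of its products with
   the orthogonal vectors. Pivots of negative norm come first: once there are three of them,
   only candidates of positive norm are left. *)
Fixpoint refuted (m : nat) (ds : seq Q) (cs : seq (seq Q)) : bool :=
  if m is m'.+1 then
    let q := count qneg ds in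
    let nrm c := resid ds c c 0 in
    let step c t := refuted m' (nrm c :: ds) (extend1 ds c t) in
    let ps := [seq c <- cs | qpos (nrm c)] in
    if eqn q 3 then each step ps [::] else
    let ns := [seq c <- cs | qneg (nrm c)] in
    let zs := [seq c <- cs | qzero (nrm c)] in
    [&& each step (ns ++ ps) zs, leq 4 (addn q m) &
      if m' is m''.+1 then
        all (fun c => all (fun c' => all (fun a =>
          let r := resid ds c c' a in
          if qzero r then true
          else refuted m'' [:: 2 * r, - (2 * r) & ds] (extend2 ds c c' zs))
        bits) zs) zs
      else true]
  else false.

Local Close Scope Q_scope.

(** * Transfer from binary rationals to [rat] *)

Definition ratZ (z : Z) : rat := (int_of_Z z)%:~R.
Definition ratQ (q : Q) : rat := ratZ (Qnum q) / ratZ (Zpos (Qden q)).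

Lemma ratZD x y : ratZ (Z.add x y) = ratZ x + ratZ y.
Proof. by rewrite /ratZ -rmorphD -(rmorphD int_of_Z). Qed.
Lemma ratZM x y : ratZ (Z.mul x y) = ratZ x * ratZ y.
Proof. by rewrite /ratZ -rmorphM -(rmorphM int_of_Z). Qed.
Lemma ratZN x : ratZ (Z.opp x) = - ratZ x.
Proof. by rewrite /ratZ -rmorphN -(rmorphN int_of_Z). Qed.

Lemma ratZ_gt0 x : (0 < ratZ x) = Z.ltb 0 x.
Proof. by rewrite /ratZ ltr0z; case: x => //= p; lia. Qed.

Lemma ratZ_lt0 x : (ratZ x < 0) = Z.ltb x 0.
Proof. by rewrite -oppr_gt0 -ratZN ratZ_gt0; case: x. Qed.

Lemma ratZ_eq0 x : (ratZ x == 0) = Z.eqb x 0.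
Proof. by rewrite /ratZ intr_eq0; case: x => //= p; apply/eqP; lia. Qed.

Lemma ratZpos_neq0 p : ratZ (Zpos p) != 0. Proof. by rewrite ratZ_eq0. Qed.
Lemma ratZpos_gt0 p : 0 < ratZ (Zpos p). Proof. by rewrite ratZ_gt0. Qed.

Lemma ratQD x y : ratQ (Qplus x y) = ratQ x + ratQ y.
Proof.
by rewrite /ratQ /= Pos2Z.inj_mul ratZD !ratZM addf_div ?ratZpos_neq0.
Qed.

Lemma ratQM x y : ratQ (Qmult x y) = ratQ x * ratQ y.
Proof. by rewrite /ratQ /= Pos2Z.inj_mul !ratZM mulf_div. Qed.

Lemma ratQN x : ratQ (Qopp x) = - ratQ x.
Proof. by rewrite /ratQ /= ratZN mulNr. Qed.

Lemma ratQV x : ratQ (Qinv x) = (ratQ x)^-1.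
Proof.
rewrite /ratQ /Qinv; case: x => [[|p|p] d] /=; rewrite invf_div.
(* Both conventions give 0 as the inverse of 0. *)
- by rewrite [ratZ 0]/(0%:~R) !(mul0r, invr0, mulr0).
- by [].
by rewrite -[Z.neg d]/(Z.opp (Zpos d)) -[Z.neg p]/(Z.opp (Zpos p)) !ratZN mulNr invrN mulrN.
Qed.

Lemma ratQ_eq x y : Qeq x y -> ratQ x = ratQ y.
Proof.
move=> /(congr1 ratZ); rewrite !ratZM /ratQ => eqxy.
by apply/eqP; rewrite eqr_div ?ratZpos_neq0 //; apply/eqP.
Qed.

Lemma ratQ_red x : ratQ (Qred x) = ratQ x.
Proof. exact/ratQ_eq/Qred_correct. Qed.

Lemma qposE q : qpos q = (0 < ratQ q).
Proof. by rewrite /ratQ pmulr_lgt0 ?invr_gt0 ?ratZpos_gt0 // ratZ_gt0. Qed.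

Lemma qnegE q : qneg q = (ratQ q < 0).
Proof. by rewrite /ratQ pmulr_llt0 ?invr_gt0 ?ratZpos_gt0 // ratZ_lt0. Qed.

Lemma qzeroE q : qzero q = (ratQ q == 0).
Proof. by rewrite /ratQ mulf_eq0 invr_eq0 (negPf (ratZpos_neq0 _)) orbF ratZ_eq0. Qed.

(** Equality of fractions as written, for list membership; values are compared through [ratQ]. *)
Definition codeQ (q : Q) := (Qnum q, Zpos (Qden q)).
Definition decodeQ (p : Z * Z) := Qmake p.1 (Z.to_pos p.2).
Lemma codeQK : cancel codeQ decodeQ. Proof. by case. Qed.
HB.instance Definition _ := Equality.copy Q (can_type codeQK).

Lemma refuted_start : refuted 10 [::] [:: [::]].
Proof. by vm_cast_no_check (erefl true). Qed.

(** * Rational symmetric forms and Gram-Schmidt *)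

Section RationalForm.
Variables (n : nat) (A : 'M[rat]_n).
Hypothesis symA : A^T = A.

Definition bform (u v : 'rV[rat]_n) : rat := (u *m A *m v^T) 0 0.

Lemma map_ratr_conj k m (V : 'M[rat]_(k, m)) :
  (map_mx ratr V) ^t* = map_mx (@ratr algC) V^T.
Proof.
apply/matrixP => i j; rewrite !mxE conj_Creal //.
exact: rpred_rat.
Qed.

Lemma map_ratr_hermitian : map_mx (@ratr algC) A \is hermsymmx.
Proof. by apply/is_hermitianmxP; rewrite expr0 scale1r map_ratr_conj symA. Qed.

Lemma gram_diag k (V : 'M[rat]_(k, n)) (u : 'rV[algC]_k) :
  (forall i j, i != j -> bform (row i V) (row j V) = 0) ->
  let W := map_mx (@ratr algC) V in
  (u *m (W *m map_mx ratr A *m W ^t*) *m u ^t*) 0 0 =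
  \sum_i ratr (bform (row i V) (row i V)) * `|u 0 i| ^+ 2.
Proof.
move=> orthV W; rewrite /W map_ratr_conj -!map_mxM /=.
have -> : V *m A *m V^T = diag_mx (\row_i bform (row i V) (row i V)).
  have VE i j : (V *m A *m V^T) i j = bform (row i V) (row j V).
    by rewrite /bform -row_mul !mxE; apply: eq_bigr => l _; rewrite !mxE.
  apply/matrixP => i j; rewrite VE !mxE.
  by have [->|/orthV ->] := eqVneq i j.
by rewrite map_diag_mx diag_form; apply: eq_bigr => i _; rewrite !mxE.
Qed.

(** Orthogonality makes the Gram matrix diagonal, so the form is nonpositive on the whole span. *)
Lemma nonpos_family (I : finType) (f : I -> 'rV[rat]_n) :
  (forall i j, i != j -> bform (f i) (f j) = 0) ->
  (forall i, bform (f i) (f i) <= 0) ->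
  (forall a : I -> rat, \sum_i a i *: f i = 0 -> forall i, a i = 0) ->
  (#|I| <= num_nonpos_eig (map_mx ratr A))%N.
Proof.
move=> orthf f_le0 freef; pose V := \matrix_(i < #|I|) f (enum_val i).
have orthV i j : i != j -> bform (row i V) (row j V) = 0.
  by move=> neq_ij; rewrite !rowK orthf ?(inj_eq enum_val_inj).
apply: (@nonpos_subspace _ _ map_ratr_hermitian _ (map_mx ratr V)).
  rewrite row_free_map; apply: inj_row_free => v vV; apply/rowP => i.
  rewrite mxE -(enum_valK i).
  apply: (freef (fun x => v 0 (enum_rank x))); rewrite -[RHS]vV.
  rewrite mulmx_sum_row (reindex _ (onW_bij _ (enum_val_bij I))) /=.
  by apply: eq_bigr => j _; rewrite rowK enum_valK.
move=> u; rewrite gram_diag //; apply: sumr_le0 => i _.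
by rewrite rowK mulr_le0_ge0 ?exprn_ge0 ?lerq0.
Qed.

Lemma pos_family (I : finType) (f : I -> 'rV[rat]_n) :
  (forall i j, i != j -> bform (f i) (f j) = 0) ->
  (forall i, 0 < bform (f i) (f i)) ->
  (num_nonpos_eig (map_mx ratr A) + #|I| <= n)%N.
Proof.
move=> orthf f_gt0; pose V := \matrix_(i < #|I|) f (enum_val i).
have orthV i j : i != j -> bform (row i V) (row j V) = 0.
  by move=> neq_ij; rewrite !rowK orthf ?(inj_eq enum_val_inj).
apply: (@pos_subspace _ _ map_ratr_hermitian _ (map_mx ratr V)).
move=> u /rV0Pn [j uj]; rewrite gram_diag // (bigD1 j) //=.
have term_ge0 i : 0 <= (ratr (bform (row i V) (row i V)) : algC) * `|u 0 i| ^+ 2.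
  by rewrite rowK mulr_ge0 ?exprn_ge0 // ler0q ltW.
by rewrite ltr_wpDr ?sumr_ge0 // rowK mulr_gt0 ?ltr0q ?exprn_gt0 ?normr_gt0.
Qed.

Lemma bformC u v : bform u v = bform v u.
Proof.
rewrite /bform; have <- : (v *m A *m u^T)^T = u *m A *m v^T.
  by rewrite !trmx_mul trmxK symA mulmxA.
by rewrite [LHS]mxE.
Qed.

Lemma bformDl u v w : bform (u + v) w = bform u w + bform v w.
Proof. by rewrite /bform !mulmxDl mxE. Qed.

Lemma bformZl a u w : bform (a *: u) w = a * bform u w.
Proof. by rewrite /bform -!scalemxAl mxE. Qed.

Lemma bformBl u v w : bform (u - v) w = bform u w - bform v w.
Proof. by rewrite bformDl -scaleN1r bformZl mulN1r. Qed.

Lemma bformDr u v w : bform w (u + v) = bform w u + bform w v.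
Proof. by rewrite bformC bformDl !(bformC _ w). Qed.

Lemma bformBr u v w : bform w (u - v) = bform w u - bform w v.
Proof. by rewrite bformC bformBl !(bformC _ w). Qed.

Lemma bform_suml (J : Type) (r : seq J) (F : J -> 'rV_n) w :
  bform (\sum_(j <- r) F j) w = \sum_(j <- r) bform (F j) w.
Proof. by rewrite /bform !mulmx_suml summxE. Qed.

Lemma bform_delta x y : bform (delta_mx 0 x) (delta_mx 0 y) = A x y.
Proof. by rewrite /bform -rowE trmx_delta -colE !mxE. Qed.

Definition orth (vs : seq 'rV[rat]_n) :=
  pairwise (fun u v => bform u v == 0) vs && all (fun v => bform v v != 0) vs.

(** The Gram-Schmidt component of [u] orthogonal to [vs]. *)
Definition residue (vs : seq 'rV[rat]_n) (u : 'rV_n) :=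
  u - \sum_(v <- vs) (bform u v / bform v v) *: v.

Lemma bform_residue vs u v : orth vs -> v \in vs -> bform (residue vs u) v = 0.
Proof.
move=> ovs vin; rewrite /residue bformBl bform_suml.
suff -> : \sum_(w <- vs) bform ((bform u w / bform w w) *: w) v = bform u v.
  by rewrite subrr.
elim: vs ovs vin => // w vs IH /andP[] /= /andP[wvs pvs] /andP[w0 nvs].
rewrite inE big_cons bformZl => /predU1P[->|vin].
  rewrite divfK // big_seq big1 ?addr0 // => z zin.
  by rewrite bformZl (bformC z) (eqP (allP wvs _ zin)) mulr0.
by rewrite (eqP (allP wvs _ vin)) mulr0 add0r IH // /orth pvs.
Qed.

Lemma bform_residuer vs u w :
  bform w (residue vs u) =
  bform w u - \sum_(v <- vs) bform u v * bform w v / bform v v.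
Proof.
rewrite bformC bformBl bform_suml bformC; congr (_ - _).
by apply: eq_bigr => v _; rewrite bformZl (bformC v) mulrAC.
Qed.

Lemma bform_residue2 vs u w : orth vs ->
  bform (residue vs w) (residue vs u) = bform w (residue vs u).
Proof.
move=> ovs; rewrite bformBl bform_suml big_seq big1 ?subr0 // => v vin.
by rewrite bformZl (bformC v) bform_residue ?mulr0.
Qed.
End RationalForm.

(** * Soundness of the search *)

Section SearchSoundness.
Variables (n : nat) (A : 'M[rat]_n).
Hypothesis symA : A^T = A.
Hypothesis A01 : forall x y, A x y = 0 \/ A x y = 1.
Hypothesis A0 : forall x, A x x = 0.

Local Notation B := (bform A).
Local Notation e y := (delta_mx 0 y : 'rV[rat]_n).
Local Notation res := (residue A).

Definition coefs (vs : seq 'rV[rat]_n) y := [seq B (e y) v | v <- vs].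
Definition residual (vs : seq 'rV[rat]_n) x y := B (res vs (e x)) (res vs (e y)).

(* [U] is the set of vertices not yet used. *)
Record config (U : {set 'I_n}) (vs : seq 'rV[rat]_n) (ds : seq Q)
    (cs : seq (seq Q)) : Prop := Config {
  config_orth : orth A vs;
  config_supp : forall v y, v \in vs -> y \in U -> v 0 y = 0;
  config_norm : map ratQ ds = [seq B v v | v <- vs];
  config_cover : forall y, y \in U -> exists2 c, c \in cs & map ratQ c = coefs vs y
}.

Lemma residual_sym vs x y : residual vs x y = residual vs y x.
Proof. by rewrite /residual bformC. Qed.

Lemma residE vs ds c c' a x y :
  map ratQ ds = [seq B v v | v <- vs] ->
  map ratQ c = coefs vs x -> map ratQ c' = coefs vs y ->
  ratQ (resid ds c c' a) =
  ratQ a - \sum_(v <- vs) B (e x) v * B (e y) v / B v v.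
Proof.
elim: vs ds c c' a => [|v vs IH] [|d ds] [|b c] [|b' c'] a //=.
  by rewrite big_nil subr0 ratQ_red.
move=> [dE dsE] [bE cE] [b'E c'E].
by rewrite (IH _ _ _ _ dsE cE c'E) ratQD ratQN ratQM ratQV ratQM dE bE b'E
  big_cons opprD addrA.
Qed.

Lemma resid_bform vs ds c c' a x y :
  map ratQ ds = [seq B v v | v <- vs] ->
  map ratQ c = coefs vs x -> map ratQ c' = coefs vs y -> ratQ a = A x y ->
  ratQ (resid ds c c' a) = B (e y) (res vs (e x)).
Proof.
move=> dsE cE c'E aE; rewrite (residE _ dsE cE c'E) aE bform_residuer //.
by rewrite bform_delta -{1}symA mxE.
Qed.

Lemma residual_bform vs x y : orth A vs ->
  residual vs x y = B (e x) (res vs (e y)).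
Proof. by move=> ovs; rewrite /residual bform_residue2. Qed.

Lemma resid_residual vs ds c c' a x y : orth A vs ->
  map ratQ ds = [seq B v v | v <- vs] ->
  map ratQ c = coefs vs x -> map ratQ c' = coefs vs y -> ratQ a = A x y ->
  ratQ (resid ds c c' a) = residual vs x y.
Proof.
move=> ovs dsE cE c'E aE.
by rewrite (resid_bform dsE cE c'E aE) residual_sym residual_bform.
Qed.

(** The vectors of [vs] vanish on [U], so subtracting them leaves these coordinates unchanged. *)
Lemma residue_supp U vs ds cs x y : config U vs ds cs -> y \in U ->
  res vs (e x) 0 y = (x == y)%:R.
Proof.
move=> cfg yU; rewrite /residue !mxE summxE big_seq big1 ?subr0 ?eqxx /=.
  by rewrite eq_sym.
by move=> v vin; rewrite mxE (config_supp cfg vin yU) mulr0.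
Qed.

Lemma bits_adj x y : exists2 a, a \in bits & ratQ a = A x y.
Proof.
have [->|->] := A01 x y; [exists (Qmake 0 1) | exists (Qmake 1 1)] => //.
Qed.

(** The negative vectors of [vs] and the residues of [S] are pairwise orthogonal. Residues may be
    isotropic, so their independence comes from supports instead. *)
Lemma isotropic_bound U vs ds cs (S : {set 'I_n}) :
  config U vs ds cs -> S \subset U ->
  (forall x, x \in S -> residual vs x x <= 0) ->
  {in S &, forall x y, x != y -> residual vs x y = 0} ->
  (count qneg ds + #|S| <= num_nonpos_eig (map_mx ratr A))%N.
Proof.
move=> cfg SU S_le0 Sorth.
have ovs := config_orth cfg; have [pvs nvs] := andP ovs.
pose ns := [seq v <- vs | B v v < 0].
have -> : count qneg ds = size ns.
  rewrite size_filter (eq_count (a2 := preim ratQ (fun q => q < 0))); last exact: qnegE.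
  by rewrite -count_map (config_norm cfg) count_map.
have ns_neg (i : 'I_(size ns)) : B ns`_i ns`_i < 0.
  by have := mem_nth 0 (ltn_ord i); rewrite mem_filter => /andP[].
have ns_in (i : 'I_(size ns)) : ns`_i \in vs.
  by have := mem_nth 0 (ltn_ord i); rewrite mem_filter => /andP[].
have ns_orth (i j : 'I_(size ns)) : i != j -> B ns`_i ns`_j = 0.
  have pns : pairwise (fun u v => B u v == 0) ns.
    by apply: subseq_pairwise pvs; apply: filter_subseq.
  have lt_orth (k l : 'I_(size ns)) : (k < l)%N -> B ns`_k ns`_l = 0.
    by move=> ltkl; apply/eqP; move/pairwiseP: pns => /(_ 0 k l); apply; rewrite ?inE.
  by rewrite neq_ltn => /orP[/lt_orth|/lt_orth]; rewrite // bformC.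
have res_ns x (i : 'I_(size ns)) : B (res vs (e x)) ns`_i = 0.
  by apply: bform_residue.
pose f (i : 'I_(size ns) + {x | x \in S}) : 'rV[rat]_n :=
  match i with inl i => ns`_i | inr x => res vs (e (val x)) end.
have -> : (size ns + #|S|)%N = #|{: 'I_(size ns) + {x | x \in S}}|.
  by rewrite card_sum card_ord card_sig.
apply: (@nonpos_family _ _ symA _ f).
- move=> [i|x] [j|y] neq_ij /=; rewrite ?res_ns //.
  + exact: ns_orth.
  + by rewrite bformC.
  + by apply: Sorth => //; apply: valP.
- by move=> [i|x] /=; [apply/ltW/ns_neg | apply: S_le0; apply: valP].
move=> a; rewrite big_sumType /= => sum0.
(* At coordinate [x] every vector of the family except the residue of [x] vanishes. *)
have aS x : a (inr x) = 0.
  have xU : val x \in U by apply: (subsetP SU); apply: valP.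
  have := congr1 (fun v : 'rV_n => v 0 (val x)) sum0.
  rewrite mxE !summxE mxE big1 ?add0r => [|i _]; last first.
    by rewrite mxE (config_supp cfg (ns_in i) xU) mulr0.
  rewrite (bigD1 x) //= big1 => [|y neq_yx].
    by rewrite mxE (residue_supp _ cfg xU) eqxx mulr1 addr0.
  by rewrite mxE (residue_supp _ cfg xU) (inj_eq val_inj) (negPf neq_yx) mulr0.
case=> [i|x]; last exact: aS.
(* Pairing with a negative vector isolates its coefficient. *)
move: sum0; rewrite [X in _ + X]big1 ?addr0 => [|x _]; last by rewrite aS scale0r.
move/(congr1 (fun v => B v ns`_i)); rewrite bform_suml (bigD1 i) //= big1.
  rewrite addr0 bformZl [RHS]/bform !mul0mx [RHS]mxE => /eqP.
  by rewrite mulf_eq0 (lt_eqF (ns_neg i)) orbF => /eqP.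
by move=> j neq_ji; rewrite bformZl ns_orth ?mulr0.
Qed.

Lemma config_extend U vs ds cs (U' : {set 'I_n}) w d cs' : config U vs ds cs ->
  U' \subset U -> {in vs, forall v, B w v = 0} -> B w w != 0 ->
  {in U', forall y, w 0 y = 0} -> ratQ d = B w w ->
  (forall y, y \in U' -> exists2 c, c \in cs' & map ratQ c = coefs (w :: vs) y) ->
  config U' (w :: vs) (d :: ds) cs'.
Proof.
move=> [/andP[pvs nvs] supp dsE _] sU wvs ww0 wU dE cov; split=> //=.
- rewrite /orth /= pvs ww0 nvs !andbT; apply/allP => v vin.
  by rewrite wvs.
- move=> v y; rewrite inE => /predU1P[->|vin] yU; first exact: wU.
  exact: supp vin (subsetP sU _ yU).
- by rewrite dE dsE.
Qed.

Lemma config_sub U vs ds cs cs' : config U vs ds cs ->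
  (forall y c, y \in U -> c \in cs -> map ratQ c = coefs vs y -> c \in cs') ->
  config U vs ds cs'.
Proof.
move=> [ovs supp dsE cov] sub; split=> // y yU.
by have [c cin cE] := cov y yU; exists c => //; apply: sub cE.
Qed.

Lemma each_sound (U : {set 'I_n}) vs ds (f : seq Q -> seq (seq Q) -> bool) (goal : Prop) s t :
  (forall x c l, x \in U -> map ratQ c = coefs vs x -> c \in s ->
     config U vs ds l -> f c l -> goal) ->
  config U vs ds (s ++ t) -> each f s t -> goal \/ config U vs ds t.
Proof.
elim: s => [|c s IH] Hf cfg /=; first by right.
case/andP => fc fs.
have [/existsP[x /andP[xU /eqP cE]]|nex] :=
    boolP [exists x, (x \in U) && (map ratQ c == coefs vs x)].
  by left; apply: Hf xU cE _ cfg fc; rewrite mem_head.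
apply: IH fs => [x c' l xU c'E c's|].
  by apply: Hf xU c'E _; rewrite inE c's orbT.
apply: config_sub cfg _ => y c' yU; rewrite inE => /predU1P[->|//] cE.
by case/negP: nex; apply/existsP; exists y; rewrite yU cE eqxx.
Qed.

Lemma extend1_config U vs ds cs c x : config U vs ds cs -> x \in U ->
  map ratQ c = coefs vs x -> residual vs x x != 0 ->
  config (U :\ x) (res vs (e x) :: vs) (resid ds c c (Qmake 0 1) :: ds) (extend1 ds c cs).
Proof.
move=> cfg xU cE nz; have ovs := config_orth cfg; have dsE := config_norm cfg.
apply: (config_extend cfg) => //.
- exact: subsetDl.
- by move=> v vin; apply: bform_residue.
- move=> y; rewrite !inE => /andP[neq yU].
  by rewrite (residue_supp _ cfg yU) eq_sym (negPf neq).
- by apply: (resid_residual ovs dsE cE cE); rewrite A0.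
move=> y; rewrite !inE => /andP[neq yU].
have [z zin zE] := config_cover cfg yU; have [a ain aE] := bits_adj x y.
exists (resid ds c z a :: z); first by apply/allpairsP; exists (z, a).
by rewrite /= (resid_bform dsE cE zE aE) zE.
Qed.

(** If [X] and [Y] are isotropic with product [r], then [X + Y] and [X - Y] are orthogonal of norms
    [2 r] and [- 2 r]. *)
Lemma extend2_config U vs ds cs c c' a x y : config U vs ds cs ->
  x \in U -> y \in U -> x != y ->
  map ratQ c = coefs vs x -> map ratQ c' = coefs vs y -> ratQ a = A x y ->
  residual vs x x = 0 -> residual vs y y = 0 -> residual vs x y != 0 ->
  let r := resid ds c c' a in
  config (U :\ x :\ y)
    [:: res vs (e x) + res vs (e y), res vs (e x) - res vs (e y) & vs]
    [:: Qmult (Qmake 2 1) r, Qopp (Qmult (Qmake 2 1) r) & ds] (extend2 ds c c' cs).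
Proof.
move=> cfg xU yU neq_xy cE c'E aE xx0 yy0 xy0 r.
have ovs := config_orth cfg; have dsE := config_norm cfg.
have rE : ratQ r = residual vs x y by apply: resid_residual.
have two : ratQ (Qmake 2 1) = 2 by [].
have suppU z u : z \in U :\ x :\ y -> u \in [:: x; y] -> res vs (e u) 0 z = 0.
  rewrite !inE => /and3P[zy zx zU] /orP[]/eqP ->;
  by rewrite (residue_supp _ cfg zU) eq_sym (negPf (_ : z != _)).
have sU : U :\ x :\ y \subset U by rewrite setDDl subsetDl.
have Xv : {in vs, forall v, B (res vs (e x)) v = 0} by move=> v; apply: bform_residue.
have Yv : {in vs, forall v, B (res vs (e y)) v = 0} by move=> v; apply: bform_residue.
have X0 z : z \in U :\ x :\ y -> res vs (e x) 0 z = 0.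
  by move=> zU; apply: suppU zU _; rewrite inE eqxx.
have Y0 z : z \in U :\ x :\ y -> res vs (e y) 0 z = 0.
  by move=> zU; apply: suppU zU _; rewrite !inE eqxx orbT.
have YX : B (res vs (e y)) (res vs (e x)) = ratQ r by rewrite rE -residual_sym.
have r0 : ratQ r != 0 by rewrite rE.
have bX u z b : map ratQ z = coefs vs u -> ratQ b = A x u ->
  ratQ (resid ds c z b) = B (e u) (res vs (e x)) by apply: resid_bform.
have bY u z b : map ratQ z = coefs vs u -> ratQ b = A y u ->
  ratQ (resid ds c' z b) = B (e u) (res vs (e y)) by apply: resid_bform.
move: xx0 yy0; rewrite /residual.
move: (res vs (e x)) (res vs (e y)) Xv Yv X0 Y0 YX bX bY {suppU xy0}.
move=> X Y Xv Yv X0 Y0 YX bX bY XX YY.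
have XY : B X Y = ratQ r by rewrite bformC.
have cov u : u \in U :\ x :\ y -> exists2 k, k \in extend2 ds c c' cs &
    map ratQ k = coefs [:: X + Y, X - Y & vs] u.
  move=> /(subsetP sU) uU; have [z zin zE] := config_cover cfg uU.
  have [b1 b1in b1E] := bits_adj x u; have [b2 b2in b2E] := bits_adj y u.
  pose b := (b1, b2); have bin : b \in [seq (a1, a2) | a1 <- bits, a2 <- bits].
    by apply/allpairsP; exists b.
  eexists; first by apply/allpairsP; exists (z, b).
  rewrite /= !ratQD ratQN (bX _ _ _ zE b1E) (bY _ _ _ zE b2E).
  by rewrite bformDr // bformBr // zE.
(* The vectors are added one at a time; removing the head of each list forgets [X + Y]. *)
have cfg1 : config (U :\ x :\ y) (X - Y :: vs)
    (Qopp (Qmult (Qmake 2 1) r) :: ds) [seq behead k | k <- extend2 ds c c' cs].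
  apply: (config_extend cfg) => //.
  - by move=> v vin; rewrite bformBl Xv // Yv // subrr.
  - by rewrite bformBl !bformBr // XX YY YX XY sub0r subr0 -opprD oppr_eq0 -mulr2n mulrn_eq0.
  - by move=> z zU; rewrite !mxE X0 // Y0 // subrr.
  - by rewrite ratQN ratQM two bformBl !bformBr // XX YY YX XY; ring.
  move=> u /cov[k kin kE]; exists (behead k); first exact: map_f.
  by rewrite -behead_map kE.
apply: (config_extend cfg1) => //.
- move=> v; rewrite inE => /predU1P[->|vin]; last by rewrite bformDl Xv // Yv // addr0.
  by rewrite bformDl !bformBr // XX YY YX XY; ring.
- by rewrite bformDl !bformDr // XX YY YX XY add0r addr0 -mulr2n mulrn_eq0.
- by move=> z zU; rewrite !mxE X0 // Y0 // addr0.
by rewrite ratQM two bformDl !bformDr // XX YY YX XY; ring.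
Qed.

(** The induction is strong because a hyperbolic pair uses two vertices at once. *)
Lemma refuted_sound m U vs ds cs : config U vs ds cs -> (m <= #|U|)%N ->
  refuted m ds cs -> (4 <= num_nonpos_eig (map_mx ratr A))%N.
Proof.
elim/ltn_ind: m U vs ds cs => -[|m] IH U vs ds cs cfg // ltmU /=.
have ovs := config_orth cfg; have dsE := config_norm cfg.
set q := count qneg ds; set step := fun c t => refuted m _ _.
have nrmE y c : map ratQ c = coefs vs y -> ratQ (resid ds c c (Qmake 0 1)) = residual vs y y.
  by move=> cE; apply: (resid_residual ovs dsE cE cE); rewrite A0.
have stepP x c l : x \in U -> map ratQ c = coefs vs x -> residual vs x x != 0 ->
    config U vs ds l -> step c l -> (4 <= num_nonpos_eig (map_mx ratr A))%N.
  move=> xU cE nz cfgl; apply: IH (extend1_config cfgl xU cE nz) _ => //.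
  by move: ltmU; rewrite (cardsD1 x) xU.
have [x0 x0U] : exists x, x \in U by apply/set0Pn; rewrite -card_gt0 (leq_trans _ ltmU).
have one_bound x : x \in U -> residual vs x x <= 0 ->
    (q.+1 <= num_nonpos_eig (map_mx ratr A))%N.
  move=> xU x_le0; rewrite -addn1 -(cards1 x); apply: (isotropic_bound cfg).
  - by rewrite sub1set.
  - by move=> y; rewrite inE => /eqP ->.
  - by move=> y z; rewrite !inE => /eqP -> /eqP ->; rewrite eqxx.
case: eqnP => [q3 | _].
  (* With three negative vectors, one nonpositive residue suffices. Otherwise all residues are
     positive, and exhausting the candidates would leave [x0] uncovered. *)
  have [/existsP[x /andP[xU x_le0]] _|nex] :=
      boolP [exists x, (x \in U) && (residual vs x x <= 0)].
    by rewrite q3 in one_bound; apply: one_bound xU x_le0.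
  move=> /(each_sound (U := U) (vs := vs) (ds := ds)
    (goal := (4 <= num_nonpos_eig (map_mx ratr A))%N)) [||//|].
  - move=> x c l xU cE; rewrite mem_filter qposE (nrmE _ _ cE) => /andP[/lt0r_neq0 nz _].
    exact: stepP xU cE nz.
  - rewrite cats0; apply: config_sub cfg _ => y c yU cin cE.
    rewrite mem_filter cin andbT qposE (nrmE _ _ cE) ltNge; apply/negP => y_le0.
    by case/negP: nex; apply/existsP; exists y; rewrite yU.
  by move=> /config_cover/(_ _ x0U) [].
set zs := [seq c <- cs | qzero _]; case/and3P => each_np le4 pairs.
have cfgs : config U vs ds (([seq c <- cs | qneg (resid ds c c (Qmake 0 1))] ++
    [seq c <- cs | qpos (resid ds c c (Qmake 0 1))]) ++ zs).
  apply: config_sub cfg _ => y c yU cin cE.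
  rewrite !mem_cat !mem_filter cin !andbT qnegE qposE qzeroE.
  by case: ltgtP.
case: (each_sound (goal := (4 <= num_nonpos_eig (map_mx ratr A))%N)
  _ cfgs each_np) => [x c l xU cE|//|cfgz].
  rewrite mem_cat !mem_filter qnegE qposE (nrmE _ _ cE) => cin.
  apply: stepP xU cE _.
  by case/orP: cin => /andP[+ _]; [apply: ltr0_neq0 | apply: lt0r_neq0].
(* Only isotropic candidates are left. *)
have z0 y : y \in U -> residual vs y y = 0.
  move=> /(config_cover cfgz) [c + cE].
  by rewrite mem_filter qzeroE (nrmE _ _ cE) => /andP[/eqP].
have [/existsP[x /existsP[y /and4P[xU yU neq_xy xy0]]]|nex] := boolP
   [exists x, exists y, [&& x \in U, y \in U, x != y & residual vs x y != 0]]; last first.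
  apply: leq_trans le4 (leq_trans _ (isotropic_bound cfg (subxx U) _ _)).
  - by rewrite leq_add2l.
  - by move=> x /z0 ->.
  - move=> x y xU yU neq_xy; apply/eqP/negPn/negP => xy0.
    by case/negP: nex; apply/existsP; exists x; apply/existsP; exists y; apply/and4P.
move: IH ltmU le4 pairs {each_np stepP step}; case: m => [|m] IH ltmU le4.
  (* Here the size test reads [4 <= q + 1], so the single residue of [x] is enough. *)
  by move=> _; apply: leq_trans (one_bound x xU _); rewrite ?z0 //; move: le4; rewrite addn1.
have [c cin cE] := config_cover cfgz xU; have [c' c'in c'E] := config_cover cfgz yU.
have pair a : ratQ a = A x y ->
    (if qzero (resid ds c c' a) then true else
     refuted m [:: Qmult (Qmake 2 1) (resid ds c c' a),
                   Qopp (Qmult (Qmake 2 1) (resid ds c c' a)) & ds]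
       (extend2 ds c c' zs)) -> (4 <= num_nonpos_eig (map_mx ratr A))%N.
  move=> aE; have rE := resid_residual ovs dsE cE c'E aE.
  rewrite qzeroE rE (negPf xy0).
  apply: IH (extend2_config cfgz xU yU neq_xy cE c'E aE (z0 _ xU) (z0 _ yU) xy0) _ => //.
  move: ltmU; rewrite (cardsD1 x) xU (cardsD1 y (U :\ x)) !inE eq_sym neq_xy yU.
  by rewrite !ltnS.
move=> /allP/(_ _ cin)/allP/(_ _ c'in)/and3P[pair0 pair1 _].
by have [a0|a1] := A01 x y; [apply: pair pair0 | apply: pair pair1].
Qed.

Lemma config_start : config setT [::] [::] [:: [::]].
Proof. by split=> // y _; exists [::]. Qed.

Lemma nonpos_ge4 : (10 <= n)%N -> (4 <= num_nonpos_eig (map_mx ratr A))%N.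
Proof.
by move=> le_n; apply: refuted_sound config_start _ refuted_start; rewrite cardsT card_ord.
Qed.
End SearchSoundness.

(** * Rational adjacency matrices and the graph on 9 vertices *)

Definition adjrat (T : finType) (e : rel T) : 'M[rat]_#|T| :=
  \matrix_(i, j) (e (enum_val i) (enum_val j))%:R.

Lemma adjmx_ratr (T : finType) (e : rel T) :
  adjmx e = map_mx ratr (adjrat e).
Proof. by apply/matrixP => i j; rewrite !mxE ratr_nat. Qed.

Lemma adjrat_sym (T : finType) (e : rel T) : symmetric e -> (adjrat e)^T = adjrat e.
Proof. by move=> sym; apply/matrixP => i j; rewrite !mxE sym. Qed.

(* A hexagon 0..5 and a triangle 6, 7, 8, with each triangle vertex joined to
   an antipodal pair of the hexagon. Its eigenvalues are 1 (twice), -2,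
   2 +- sqrt 2, and -1 +- sqrt 2 (twice each), hence 6 positive ones. *)
Definition hextri (x y : nat) : bool :=
  match (x < 6)%N, (y < 6)%N with
  | true, true => (y == x.+1 %[mod 6]) || (x == y.+1 %[mod 6])
  | false, false => x != y
  | _, _ => x == y %[mod 3]
  end.

Definition hextri_rel : rel 'I_9 := fun x y => hextri x y.

Lemma hextri_simple : simple_graph hextri_rel.
Proof.
split=> [x y|x]; rewrite /hextri_rel /hextri.
  by case: ltnP => _; case: ltnP => _;
    [exact: orbC | exact: eq_sym | exact: eq_sym | rewrite eq_sym].
have : all (fun z => ~~ hextri z z) (iota 0 9) by [].
by move/allP/(_ (val x)); rewrite mem_iota ltn_ord => /(_ isT)/negPf.
Qed.

(* Orthogonal for the adjacency form, adapted to the decomposition under the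
   symmetries: two vectors odd under the antipodal map, two even of sum zero on
   the hexagon, and two constant on the hexagon and on the triangle. *)
Definition hextri_basis : seq (seq int) :=
  [:: [:: 1; 1; 0; -1; -1; 0; 0; 0; 0];
      [:: 1; -1; -1; -1; 1; 1; 0; 0; 0];
      [:: 1; -1; 0; 1; -1; 0; 2; -2; 0];
      [:: 1; 1; -2; 1; 1; -2; 2; 2; -4];
      [:: 1; 1; 1; 1; 1; 1; 0; 0; 0];
      [:: 1; 1; 1; 1; 1; 1; -2; -2; -2]].

Definition sumz (s : seq int) : int := foldr +%R 0 s.

(** The adjacency form on integer lists, in a form that [vm_compute] can evaluate. *)
Definition hextri_form (v w : seq int) : int :=
  sumz [seq sumz [seq v`_x * (hextri x y)%:R * w`_y | y <- iota 0 9] | x <- iota 0 9].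

Definition vec (v : seq int) : 'rV[rat]_#|'I_9| := \row_i (v`_(enum_val i : 'I_9))%:~R.

Lemma sum_enum_val_iota (F : nat -> int) :
  \sum_(i < #|'I_9|) F (enum_val i : 'I_9) = sumz [seq F x | x <- iota 0 9].
Proof.
rewrite /sumz foldrE big_map -[iota 0 9]/(index_iota 0 9) big_mkord.
by rewrite [RHS](reindex _ (onW_bij _ (enum_val_bij 'I_9))).
Qed.

Lemma bform_vec v w : bform (adjrat hextri_rel) (vec v) (vec w) = (hextri_form v w)%:~R.
Proof.
have -> : hextri_form v w = \sum_(i < #|'I_9|) \sum_(j < #|'I_9|)
    v`_(enum_val i : 'I_9) * (hextri_rel (enum_val i) (enum_val j))%:R
    * w`_(enum_val j : 'I_9).
  rewrite /hextri_form -sum_enum_val_iota; apply: eq_bigr => i _.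
  exact/esym/sum_enum_val_iota.
rewrite /bform -mulmxA mxE rmorph_sum; apply: eq_bigr => i _.
rewrite !mxE mulr_sumr rmorph_sum; apply: eq_bigr => j _.
by rewrite !mxE /= !rmorphM /= rmorph_nat mulrA.
Qed.

Lemma hextri_num_nonpos : (num_nonpos_eig (adjmx hextri_rel) <= 3)%N.
Proof.
pose f (i : 'I_6) := vec (nth [::] hextri_basis i).
have form_check : all (fun i => all (fun j =>
    let q := hextri_form (nth [::] hextri_basis i) (nth [::] hextri_basis j) in
    if i == j then 0 < q else q == 0) (iota 0 6)) (iota 0 6) by vm_compute.
have formP (i j : 'I_6) :
    let q := hextri_form (nth [::] hextri_basis i) (nth [::] hextri_basis j) in
    if i == j then 0 < q else q == 0.
  by apply: (allP (allP form_check i _) j _); rewrite mem_iota ltn_ord.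
have [sym _] := hextri_simple.
(* Six orthogonal vectors of positive norm leave at most [9 - 6 = 3] nonpositive eigenvalues. *)
have le9 : (num_nonpos_eig (map_mx ratr (adjrat hextri_rel)) + #|'I_6| <= #|'I_9|)%N.
  apply: (pos_family (adjrat_sym sym) (f := f)) => [i j neq_ij|i]; rewrite bform_vec.
    by have := formP i j; rewrite (negPf neq_ij) => /eqP ->.
  by have := formP i i; rewrite eqxx ltr0z.
move: le9; rewrite -adjmx_ratr [#|'I_6|]card_ord [X in (_ <= X)%N]card_ord; lia.
Qed.

Theorem mainTheorem8 : is_NPO 4 10.
Proof.
split=> [T e [sym irr] le_T|n NPO_n].
  rewrite adjmx_ratr; apply: nonpos_ge4 (adjrat_sym sym) _ _ le_T => [x y|x].
    by rewrite mxE; case: (e _ _); [right | left].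
  by rewrite mxE irr.
rewrite leqNgt; apply/negP => lt_n.
have le_n : (n <= #|'I_9|)%N by rewrite card_ord.
by have := leq_trans (NPO_n _ _ hextri_simple le_n) hextri_num_nonpos.
Qed.
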